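(* The following three statements are all equivalent. (i) (Duffin-Schaeffer conjecture) For every function $\psi:\mathbb{N}\to[0,\infty)$, if $\sum_{n=1}^{\infty}\frac{\psi(n)}{n}\varphi(n)=\infty$, then $\lambda(W(\psi))=1$. (ii) For every dimension function $f$ such that $r^{-1}f(r)$ tends increasingly to $\infty$ as $r\to0$, and for every function $\psi:\mathbb{N}\to[0,\infty)$, if $\sum_{n=1}^{\infty}\frac{\psi(n)}{n}\varphi(n)=\infty$, then $\mathcal{H}^f(W(\psi))=\infty$. (iii) For every increasing non-negative function $f:[0,\infty)\to\mathbb{R}$ such that $r^{-1}f(r)\to0$ as $r\to0$, and for every function $\psi:\mathbb{N}\to[0,\infty)$, if $\sum_{n=1}^{\infty}f\big(\frac{\psi(n)}{n}\big)\varphi(n)=\infty$, then $\lambda(W(\psi))=1$.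
   Context: $\mathbb{N}$ is the set of positive integers, $\varphi$ is the Euler phi function, and $\lambda$ is the Lebesgue measure on $\mathbb{R}/\mathbb{Z}$. For a function $\psi:\mathbb{N}\to[0,\infty)$ and $n\in\mathbb{N}$, define the subset of $\mathbb{R}/\mathbb{Z}$ $$\mathcal{E}_n(\psi)=\bigcup_{1\le m\le n,\ (m,n)=1}\Big(\frac{m-\psi(n)}{n},\frac{m+\psi(n)}{n}\Big)$$ (intervals taken modulo $1$; $(m,n)$ under the union is the gcd), and $W(\psi)=\bigcap_{m=1}^{\infty}\bigcup_{n=m}^{\infty}\mathcal{E}_n(\psi)$. A dimension function is a continuous, non-decreasing function $f:\mathbb{R}^{+}\to\mathbb{R}^{+}$ such that $f(r)\to0$ as $r\to0$. For $\rho>0$, a $\rho$-cover of $A\subset\mathbb{R}$ is a countable collection $\{B_i\}$ of open intervals with radii $r_i\le\rho$ such that $A\subset\bigcup_iB_i$. Put $\mathcal{H}^f_\rho(A)=\inf\sum_i f(r_i)$, the infimum being over all $\rho$-covers of $A$; the Hausdorff $f$-measure of $A$ is $\mathcal{H}^f(A)=\lim_{\rho\to0}\mathcal{H}^f_\rho(A)$. Subsets of $\mathbb{R}/\mathbb{Z}$ are identified with subsets of $[0,1)$ for this purpose. *)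

(* Defs.v *)
From HB Require Import structures.
From mathcomp Require Export all_boot all_order all_algebra.
From mathcomp Require Export all_classical all_reals all_analysis.

Set Implicit Arguments.
Unset Strict Implicit.
Unset Printing Implicit Defensive.

Import Order.TTheory GRing.Theory Num.Theory.
Import numFieldNormedType.Exports.

Local Open Scope classical_set_scope.
Local Open Scope ring_scope.

(* R/Z is represented by its fundamental domain [0, 1); [mod1] is the
   projection R -> R/Z, and the Lebesgue measure of R/Z is that of R restricted
   to subsets of [0, 1). *)
Definition mod1 (R : realType) (x : R) : R := x - (Num.floor x)%:~R.

Definition approx_set (R : realType) (psi : nat -> R) (n : nat) : set R :=
  \bigcup_(m in [set m : nat | (1 <= m <= n)%N /\ coprime m n])
    (@mod1 R @` `](m%:R - psi n) / n%:R, (m%:R + psi n) / n%:R[%classic).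

(* [lim_sup_set] starts at n = 0, which is harmless: [approx_set psi 0] is
   empty, as no m satisfies 1 <= m <= 0. *)
Definition well_approx_set (R : realType) (psi : nat -> R) : set R :=
  lim_sup_set (approx_set psi).

(* Dimension functions live on (0, +oo); the values of f on (-oo, 0] are
   irrelevant. *)
Definition dimension_function (R : realType) (f : R -> R) : Prop :=
  [/\ forall r, 0 < r -> 0 < f r,
      {within [set r : R | 0 < r], continuous f},
      forall r s, 0 < r -> r <= s -> f r <= f s
    & f r @[r --> 0^'+] --> (0 : R)].

(* The cover consists of the intervals (c i - r i, c i + r i), i \in D; the
   index set D : set nat may be finite or infinite. *)
Definition is_cover (R : realType) (rho : R) (A : set R)
    (D : set nat) (c r : nat -> R) : Prop :=
  (forall i, D i -> 0 < r i <= rho) /\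
  A `<=` \bigcup_(i in D) `]c i - r i, c i + r i[%classic.

Definition hausdorff_content (R : realType) (f : R -> R) (rho : R)
    (A : set R) : \bar R :=
  ereal_inf [set x | exists D c r,
    is_cover rho A D c r /\ x = \esum_(i in D) (f (r i))%:E].

Definition hausdorff_measure (R : realType) (f : R -> R) (A : set R) : \bar R :=
  lim (hausdorff_content f rho A @[rho --> 0^'+]).

(* Main.v *)
Require Import Defs.
From mathcomp Require Import all_boot all_order all_algebra.
From mathcomp Require Import all_classical all_reals all_analysis.
From mathcomp Require Import measurable_realfun ring lra zify.
Import Order.TTheory GRing.Theory Num.Theory.
Import numFieldNormedType.Exports.
Local Open Scope classical_set_scope.
Local Open Scope ring_scope.

(** (i) implies (ii): on a rho-cover, [f r >= K r] for the radii that occur, so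
    [sum f (r i) >= K / 2 * lambda W], and K tends to infinity with 1 / rho.

    (ii) implies (iii): divergence of [sum f(psi(n)/n) phi(n)] forces divergence of
    [sum psi(n)/n phi(n)]. A null set has finite f-measure for some dimension function f
    with f(r)/r increasing to infinity, so (ii) shows that W is never null under
    divergence. To reach full measure, replace psi by a psi' = o(psi) that still diverges
    (Abel-Dini). The points lying, for some constant M, in infinitely many of the sets
    for M psi' form a subset V of W modulo 1 with positive measure. This V splits
    according to whether a prime p divides n not at all, exactly once, or at least twice:
    the first two parts are mapped into themselves by [x -> p x] and [x -> p x + 1/p], the
    third is 1/p-periodic, and the Lebesgue density theorem yields full measure, as in
    Gallagher's zero-one law; the union over M makes Cassels' lemma unnecessary.

    (iii) implies (i): choose f(r) = r g(r), with g tending to 0 so slowly that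
    [sum g(psi(n)/n) psi(n)/n phi(n)] still diverges. *)

(** * Divergent series *)

Section Series.
Context {R : realType}.
Implicit Types a : nat -> R.

Lemma nneseries_pinftyP a (a0 : forall n, (0 < n)%N -> 0 <= a n) :
  (\sum_(1 <= n <oo) (a n)%:E = +oo)%E <->
  forall M, exists N, M <= \sum_(1 <= n < N) a n.
Proof.
have a0' n : (1 <= n)%N -> true -> (0 <= (a n)%:E)%E by move=> n1 _; rewrite lee_fin a0.
split=> [ay M|aub].
- apply: contrapT => /forallNP aM.
  have : (\sum_(1 <= n <oo) (a n)%:E <= M%:E)%E.
    apply: lime_le; first exact: is_cvg_nneseries.
    apply: nearW => N; rewrite sumEFin lee_fin.
    by case: (leP (\sum_(1 <= n < N) a n) M) => // /ltW /aM.
  by rewrite ay.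
- apply/eqyP => M _; have [N aN] := aub M.
  apply: (le_trans _ (nneseries_lim_ge N a0')).
  by rewrite sumEFin lee_fin.
Qed.

Lemma sum_unbounded_le a b : (forall n, (0 < n)%N -> a n <= b n) ->
  (forall M, exists N, M <= \sum_(1 <= n < N) a n) ->
  forall M, exists N, M <= \sum_(1 <= n < N) b n.
Proof.
move=> ab aub M; have [N aN] := aub M; exists N; apply: (le_trans aN).
by apply: ler_sum_nat => n /andP[n0 _]; exact: ab.
Qed.

Lemma ler_sum_widen a (m n : nat) : (forall n, (0 < n)%N -> 0 <= a n) ->
  (m <= n)%N -> \sum_(1 <= i < m) a i <= \sum_(1 <= i < n) a i.
Proof.
move=> a0 mn; have [m1|m1] := ltnP m 1.
  by rewrite big_geq 1?ltnW// big_nat_cond sumr_ge0// => i /andP[/andP[/a0]].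
rewrite (big_cat_nat (n:=m) (p:=n))//= lerDl big_nat_cond sumr_ge0// => i.
by case/andP=> /andP[mi _] _; apply: a0; exact: leq_trans mi.
Qed.

(** With [S] the partial sums, choose M with [S M >= 1 + 2 * S N]: the terms from N to M - 1 then
    contribute at least [(S M - S N) / (1 + S M) >= 1/2]. Such blocks can be repeated
    indefinitely. *)
Lemma abel_dini a (a0 : forall n, (0 < n)%N -> 0 <= a n) :
  (forall M, exists N, M <= \sum_(1 <= n < N) a n) ->
  forall M, exists N,
    M <= \sum_(1 <= n < N) (a n / (1 + \sum_(1 <= m < n.+1) a m)).
Proof.
move=> aub.
set S := fun N => \sum_(1 <= m < N) a m.
set B := fun N => \sum_(1 <= n < N) (a n / (1 + S n.+1)).
have S0 n : 0 <= S n by rewrite /S big_nat_cond sumr_ge0// => i /andP[/andP[/a0]].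
have S1 n : 0 < 1 + S n by rewrite ltr_pwDl.
have step N : (0 < N)%N -> exists2 N', (0 < N')%N & B N + 2^-1 <= B N'.
  move=> N0; have [M SM] := aub (1 + 2 * S N); rewrite -/(S M) in SM.
  have NM : (N <= M)%N.
    rewrite leqNgt; apply/negP => /ltnW MN.
    by have := ler_sum_widen _ _ _ a0 MN; rewrite -/(S _) -/(S _); have := S0 N; lra.
  exists M; first exact: leq_trans NM.
  rewrite /B (big_cat_nat (n:=N) (p:=M))//= lerD2l.
  have : (S M - S N) / (1 + S M) <= \sum_(N <= i < M) a i / (1 + S i.+1).
    rewrite {1}/S (big_cat_nat (n:=N) (p:=M))//= -/(S N) addrAC subrr add0r mulr_suml.
    apply: ler_sum_nat => i /andP[Ni iM].
    apply: ler_wpM2l; first by apply: a0; exact: leq_trans Ni.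
    by rewrite lef_pV2 ?posrE// lerD2l ler_sum_widen.
  apply: le_trans; rewrite ler_pdivlMr//; have := S0 N; lra.
have {}step k : exists2 N, (0 < N)%N & k%:R * 2^-1 <= B N.
  elim: k => [|k [N N0 IH]].
    by exists 1%N => //; rewrite mul0r /B big_geq.
  have [N' N'0 NN'] := step _ N0; exists N' => //.
  by apply: le_trans NN'; rewrite -natr1; lra.
move=> M.
have [N _ BN] := step (Num.trunc `|M * 2|).+1.
exists N; apply: le_trans BN.
have := truncnS_gt `|M * 2|; have := ler_norm (M * 2); lra.
Qed.

End Series.

(** * Vanishing weights that preserve divergence *)

Section Dini.
Context {R : realType}.
Implicit Types a r : nat -> R.

(** Halving drives this positive sequence to 0. The minimum keeps it below each positive [r n] with
    n at least 1, so that [dini_gauge] admits the index n at scale [r n]. *)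
Fixpoint threshold r (n : nat) : R :=
  if n is m.+1 then
    let d := threshold r m / 2 in
    if 0 < r n then Num.min d (r n) else d
  else 1.

Lemma threshold_gt0 r n : 0 < threshold r n.
Proof.
elim: n => //= n IH; case: ifP => rn; rewrite ?lt_min ?rn ?andbT; exact: divr_gt0.
Qed.

Lemma threshold_half r n : threshold r n.+1 <= threshold r n / 2.
Proof. by rewrite /=; case: ifP => // _; rewrite ge_min lexx. Qed.

Lemma threshold_le r n : (0 < n)%N -> 0 < r n -> threshold r n <= r n.
Proof. by case: n => //= n _ ->; rewrite ge_min lexx orbT. Qed.

Lemma threshold_decr r m n : (m <= n)%N -> threshold r n <= threshold r m.
Proof.
elim: n => [|n IH]; first by rewrite leqn0 => /eqP ->.
rewrite leq_eqVlt => /orP[/eqP ->//|]; rewrite ltnS => /IH.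
apply: le_trans; have := threshold_half r n; have := threshold_gt0 r n; lra.
Qed.

Lemma threshold_cvg0 r x : 0 < x -> exists n, threshold r n <= x.
Proof.
move=> x0; have [n nx] : exists n, x^-1 <= n%:R :> R.
  exists (Num.trunc x^-1).+1; exact/ltW/truncnS_gt.
(* The rate [1 / (n + 1)] is cruder than the geometric one but suffices; the induction uses
   [(m + 2) / 2 <= m + 1]. *)
exists n; have nn : (n%:R + 1) * threshold r n <= 1.
  elim: (n) => [|m IH]; first by rewrite add0r mul1r.
  apply: le_trans IH; rewrite -natr1.
  apply: (@le_trans _ _ ((m%:R + 1 + 1) * (threshold r m / 2))).
    by rewrite ler_wpM2l ?threshold_half// !addr_ge0.
  rewrite mulrCA mulrC -subr_ge0.
  have -> : (m%:R + 1) * threshold r m - (m%:R + 1 + 1) / 2 * threshold r m =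
    m%:R * threshold r m / 2 by field.
  by rewrite !mulr_ge0// ltW// threshold_gt0.
have n0 : 0 < n%:R :> R by apply: lt_le_trans nx; rewrite invr_gt0.
have : x^-1 * threshold r n <= 1.
  apply: le_trans nn; apply: ler_wpM2r; first exact/ltW/threshold_gt0.
  by apply: (le_trans nx); rewrite lerDl.
by rewrite mulrC ler_pdivrMr// mul1r.
Qed.

Lemma dini_gauge a r : (forall n, (0 < n)%N -> 0 <= a n) ->
  (forall n, (0 < n)%N -> a n != 0 -> 0 < r n) ->
  (forall M, exists N, M <= \sum_(1 <= n < N) a n) ->
  exists g : R -> R, [/\ forall x, 0 < x -> 0 < g x,
    forall x y, 0 < x -> x <= y -> g x <= g y,
    g x @[x --> 0^'+] --> 0
    & forall M, exists N, M <= \sum_(1 <= n < N) (g (r n) * a n)].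
Proof.
move=> a0 ar aub.
pose S N := \sum_(1 <= m < N) a m.
pose w n := (1 + S n.+1)^-1.
have S1 n : 0 < 1 + S n.
  by rewrite ltr_pwDl// /S big_nat_cond sumr_ge0// => i /andP[/andP[/a0]].
have w0 n : 0 < w n by rewrite invr_gt0.
have wdecr m n : (m <= n)%N -> w n <= w m.
  by move=> mn; rewrite lef_pV2 ?posrE// lerD2l ler_sum_widen.
pose E x := [set y | exists2 n, threshold r n <= x & y = w n].
have Eub x M : (forall n, threshold r n <= x -> w n <= M) -> ubound (E x) M.
  by move=> xM _ [n nx ->]; exact: xM.
have Eub1 x : ubound (E x) (w 0%N) by apply: Eub => n _; exact: wdecr.
have Ene x : 0 < x -> E x !=set0.
  by move=> /(threshold_cvg0 r)[n nx]; exists (w n); exists n.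
have wE n x : threshold r n <= x -> w n <= sup (E x).
  by move=> nx; apply: ub_le_sup; [exists (w 0%N)|exists n].
exists (fun x => sup (E x)); split.
- by move=> x /(threshold_cvg0 r)[n nx]; exact: lt_le_trans (wE _ _ nx).
- move=> x y x0 xy; apply: ge_sup; first exact: Ene.
  by apply: Eub => n nx; apply: wE; exact: le_trans xy.
- apply/cvgrPdist_le => /= e e0; have [N SN] := aub e^-1.
  have wN : w N <= e.
    rewrite -[e]invrK lef_pV2 ?posrE ?invr_gt0//; apply: (le_trans SN).
    by apply: (@le_trans _ _ (S N.+1)); rewrite ?ler_sum_widen// lerDr.
  near=> x; have x0 : 0 < x by [].
  rewrite sub0r normrN ger0_norm; last first.
    by have [n nx] := threshold_cvg0 r x x0; apply: le_trans (wE _ _ nx); exact: ltW.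
  apply: ge_sup; first exact: Ene.
  apply: Eub => n nx; apply: le_trans wN; apply: wdecr.
  have xN : x < threshold r N by near: x; exact/nbhs_right_lt/threshold_gt0.
  rewrite leqNgt; apply/negP => /ltnW/(threshold_decr r) Nn.
  by have := lt_le_trans xN Nn; rewrite ltNge nx.
- apply: sum_unbounded_le (abel_dini a a0 aub) => n n0.
  have [->|an0] := eqVneq (a n) 0; first by rewrite mul0r mulr0.
  rewrite mulrC ler_wpM2r ?a0//; apply: wE.
  by apply: threshold_le => //; exact: ar.
Unshelve. all: by end_near. Qed.

End Dini.

(** * Dimension functions adapted to null sets *)

Section SlowGauge.
Context {R : realType}.

(** Cut where the tail of u drops to [e / 2], a bound uniform in s; the head is at most [N * s],
    which is small for small s. *)
Lemma nneseries_min_small (u : nat -> R) (e : R) : (forall i, 0 <= u i) ->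
  (\sum_(i <oo) (u i)%:E < +oo)%E -> 0 < e ->
  exists2 t, 0 < t & forall s, 0 <= s <= t ->
    (\sum_(i <oo) (Num.min (u i) s)%:E <= e%:E)%E.
Proof.
move=> u0 uoo e0.
have uE0 i : xpredT i -> (0 <= (u i)%:E)%E by rewrite lee_fin.
have /fine_cvgP[tfin tcvg] := nneseries_tail_cvg uoo uE0.
have e20 : 0 < e / 2 by exact: divr_gt0.
have /cvgrPdist_le/(_ _ e20) tsmall := tcvg.
have [N _ /(_ N (leqnn N))[Nfin tN]] : \forall N \near \oo,
    (\sum_(N <= k <oo) (u k)%:E \is a fin_num)%E /\
    `|0 - fine (\sum_(N <= k <oo) (u k)%:E)%E| <= e / 2.
  by near=> N; split; near: N.
exists (e / 2 / N.+1%:R) => [|s /andP[s0 st]]; first exact: divr_gt0.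
have m0 i : (0 <= (Num.min (u i) s)%:E)%E by rewrite lee_fin le_min u0.
rewrite (nneseries_split 0 N)// add0n [e]splitr EFinD leeD//.
- rewrite sumEFin lee_fin.
  apply: (@le_trans _ _ (\sum_(0 <= i < N) s)).
    by apply: ler_sum => i _; rewrite ge_min lexx orbT.
  rewrite sumr_const_nat subn0 -[leLHS]mulr_natl.
  apply: (@le_trans _ _ (N.+1%:R * s)); first by rewrite ler_wpM2r// ler_nat.
  by rewrite mulrC -ler_pdivlMr.
- apply: (@le_trans _ _ (\sum_(N <= k <oo) (u k)%:E)%E).
    by apply: lee_nneseries => // n _; rewrite lee_fin ge_min lexx.
  rewrite -[leLHS]fineK// lee_fin; apply: le_trans tN.
  by rewrite sub0r normrN ler_norm.
Unshelve. all: by end_near. Qed.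

Lemma hyperbola_ge0 (s x : R) : 0 <= s -> 0 <= x -> 0 <= x * s / (x + s).
Proof. by move=> s0 x0; rewrite divr_ge0 ?mulr_ge0 ?addr_ge0. Qed.

Lemma hyperbola_le_min (s x : R) : 0 < s -> 0 < x ->
  x * s / (x + s) <= Num.min x s.
Proof.
move=> s0 x0; have xs : 0 < x + s by exact: addr_gt0.
by rewrite le_min !ler_pdivrMr// !mulrDr (mulrC s x) lerDr lerDl -!expr2 !sqr_ge0.
Qed.

Lemma hyperbola_homo (s x y : R) : 0 < s -> 0 < x -> x <= y ->
  x * s / (x + s) <= y * s / (y + s).
Proof.
move=> s0 x0 xy; have y0 : 0 < y by exact: lt_le_trans xy.
rewrite ler_pdivrMr ?addr_gt0// mulrAC ler_pdivlMr ?addr_gt0//.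
rewrite -subr_ge0.
have -> : y * s * (x + s) - x * s * (y + s) = (y - x) * (s * s) by ring.
by rewrite !mulr_ge0 ?subr_ge0// ltW.
Qed.

Variable s : nat -> R.
Hypothesis s_gt0 : forall l, 0 < s l.
Hypothesis s_fin : (\sum_(l <oo) (s l)%:E < +oo)%E.

(** Each summand is half the harmonic mean of x and [s l], a smooth substitute for their minimum. It
    is at most that minimum and nondecreasing in x, and its quotient by x, [s l / (x + s l)], is
    strictly decreasing. *)
Definition slow_gauge (x : R) : R := fine (\sum_(l <oo) (x * s l / (x + s l))%:E)%E.

Let term_ge0 x l : 0 < x -> (0 <= (x * s l / (x + s l))%:E)%E.
Proof. by move=> x0; rewrite lee_fin hyperbola_ge0// ltW. Qed.

Lemma slow_gaugeE x : 0 < x ->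
  (slow_gauge x)%:E = (\sum_(l <oo) (x * s l / (x + s l))%:E)%E.
Proof.
move=> x0; rewrite fineK// ge0_fin_numE; last by apply: nneseries_ge0 => l _ _; exact: term_ge0.
apply: le_lt_trans s_fin; apply: lee_nneseries => l; first by move=> _ _; exact: term_ge0.
by move=> _; rewrite lee_fin (le_trans (hyperbola_le_min _ _ _ _))// ge_min lexx orbT.
Qed.

Lemma slow_gauge_homo x y : 0 < x -> x <= y -> slow_gauge x <= slow_gauge y.
Proof.
move=> x0 xy; have y0 : 0 < y by exact: lt_le_trans xy.
rewrite -lee_fin !slow_gaugeE//; apply: lee_nneseries => [l _ _|l _]; first exact: term_ge0.
by rewrite lee_fin hyperbola_homo.
Qed.

Lemma slow_gauge_gt0 x : 0 < x -> 0 < slow_gauge x.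
Proof.
move=> x0; rewrite -lte_fin slow_gaugeE// nneseries_recl//; last by move=> l _; exact: term_ge0.
apply: (@lt_le_trans _ _ (x * s 0%N / (x + s 0%N))%:E).
  by rewrite lte_fin divr_gt0 ?mulr_gt0 ?addr_gt0.
by rewrite leeDl//; apply: nneseries_ge0 => l _ _; exact: term_ge0.
Qed.

Let ratioE x : 0 < x -> (x^-1 * slow_gauge x)%:E = (\sum_(l <oo) (s l / (x + s l))%:E)%E.
Proof.
move=> x0; rewrite EFinM slow_gaugeE// -nneseriesZl//; last by move=> l _; exact: term_ge0.
apply: eq_eseriesr => l _; rewrite -EFinM; congr EFin.
by rewrite mulrA mulrA mulVf ?mul1r ?gt_eqF.
Qed.

Let ratio_ge0 x l : 0 < x -> (0 <= (s l / (x + s l))%:E)%E.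
Proof. by move=> x0; rewrite lee_fin divr_ge0 ?addr_ge0 ?ltW. Qed.

Lemma slow_gauge_ratio_decr x y : 0 < x -> x < y ->
  y^-1 * slow_gauge y < x^-1 * slow_gauge x.
Proof.
move=> x0 xy; have y0 : 0 < y by exact: lt_trans xy.
have le_term l : s l / (y + s l) <= s l / (x + s l).
  by rewrite ler_pM2l// lef_pV2 ?posrE ?addr_gt0// lerD2r ltW.
have := ratioE y y0; have := ratioE x x0.
rewrite nneseries_recl//; last by move=> l _; exact: ratio_ge0.
move=> Ex; rewrite nneseries_recl//; last by move=> l _; exact: ratio_ge0.
(* Strictness comes from the term [l = 0]; the tail must be finite for it to survive the
   addition. *)
move=> Ey; rewrite -lte_fin Ex Ey; apply: lte_leD.
- have T0 : (0 <= \sum_(1 <= l <oo) (s l / (y + s l))%:E)%E.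
    by apply: nneseries_ge0 => l _ _; exact: ratio_ge0.
  rewrite ge0_fin_numE//; apply: (@le_lt_trans _ _ (y^-1 * slow_gauge y)%:E); last exact: ltry.
  by rewrite Ey leeDr//; exact: ratio_ge0.
- by rewrite lte_fin ltr_pM2l// ltf_pV2 ?posrE ?addr_gt0// ltrD2r.
- by apply: lee_nneseries => [l _ _|l _]; [exact: ratio_ge0|rewrite lee_fin].
Qed.

Lemma slow_gauge_cvg0 : slow_gauge x @[x --> 0^'+] --> 0.
Proof.
apply/cvgrPdist_le => /= e e0.
have [t t0 tE] := nneseries_min_small s e (fun l => ltW (s_gt0 l)) s_fin e0.
near=> x; have x0 : 0 < x by [].
rewrite sub0r normrN ger0_norm; last exact/ltW/slow_gauge_gt0.
rewrite -lee_fin slow_gaugeE//; apply: le_trans (tE x _); last first.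
  by rewrite ltW//=; near: x; exact: nbhs_right_ltW.
apply: lee_nneseries => [l _ _|l _]; first exact: term_ge0.
by rewrite lee_fin minC hyperbola_le_min.
Unshelve. all: by end_near. Qed.

(** Every l with [s l >= x] contributes at least 1/2 to the quotient, and a small x lies below the
    first N scales; hence the factor 2 in N. *)
Lemma slow_gauge_ratio_cvgy : x^-1 * slow_gauge x @[x --> 0^'+] --> +oo.
Proof.
apply/cvgryPge => A; pose N := (2 * (Num.trunc `|A|).+1)%N.
have [t t0 st] : exists2 t, 0 < t & forall l, (l < N)%N -> t <= s l.
  elim: N => [|N [t t0 IH]]; first by exists 1.
  exists (Num.min t (s N)) => [|l]; first by rewrite lt_min t0 s_gt0.
  rewrite ltnS leq_eqVlt => /orP[/eqP ->|/IH]; first by rewrite ge_min lexx orbT.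
  by move=> tl; rewrite ge_min tl.
near=> x; have x0 : 0 < x by [].
rewrite -lee_fin ratioE//.
apply: le_trans (nneseries_lim_ge N _) => [|l _ _]; last exact: ratio_ge0.
rewrite sumEFin lee_fin.
apply: (@le_trans _ _ (\sum_(0 <= l < N) 2^-1)).
  rewrite sumr_const_nat subn0 -[leRHS]mulr_natl /N natrM.
  rewrite mulrAC mulfV// mul1r.
  by have := truncnS_gt `|A|; have := ler_norm A; lra.
apply: ler_sum_nat => l /andP[_ lN]; rewrite ler_pdivlMr ?addr_gt0//.
have xt : x <= t by near: x; exact: nbhs_right_ltW.
by have := st _ lN; lra.
Unshelve. all: by end_near. Qed.

Lemma slow_gauge_continuous x : 0 < x -> {for x, continuous slow_gauge}.
Proof.
move=> x0; have g0 := slow_gauge_gt0 x x0.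
(* [slow_gauge y] lies between [slow_gauge x] and [(y / x) * slow_gauge x]. *)
have bound y : 0 < y -> `|slow_gauge x - slow_gauge y| <= x^-1 * slow_gauge x * `|x - y|.
  move=> y0; have [xy|yx|->] := ltgtP x y; last by rewrite !subrr normr0 mulr0.
  - have := slow_gauge_ratio_decr x y x0 xy; have := slow_gauge_homo x y x0 (ltW xy).
    move=> H1 H2; rewrite distrC (distrC x) !ger0_norm ?subr_ge0//; last exact: ltW.
    have -> : x^-1 * slow_gauge x * (y - x) = x^-1 * slow_gauge x * y - slow_gauge x.
      by field; rewrite gt_eqF.
    by rewrite lerD2r -ler_pdivrMr// mulrC ltW.
  - have := slow_gauge_ratio_decr y x y0 yx; have := slow_gauge_homo y x y0 (ltW yx).
    move=> H1 H2; rewrite !ger0_norm ?subr_ge0//; last exact: ltW.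
    have -> : x^-1 * slow_gauge x * (x - y) = slow_gauge x - x^-1 * slow_gauge x * y.
      by field; rewrite gt_eqF.
    by rewrite lerD2l lerN2 -ler_pdivlMr// [leRHS]mulrC ltW.
apply/cvgrPdist_le => /= e e0; near=> y.
have y0 : 0 < y by near: y; exact: lt_nbhsr.
apply: (le_trans (bound y y0)); rewrite mulrC -ler_pdivlMr ?mulr_gt0 ?invr_gt0//.
near: y; apply: cvgr_dist_le; first exact: cvg_id.
by rewrite divr_gt0 ?mulr_gt0 ?invr_gt0.
Unshelve. all: by end_near. Qed.

Lemma dimension_function_slow_gauge : dimension_function slow_gauge.
Proof.
split; [exact: slow_gauge_gt0| |exact: slow_gauge_homo|exact: slow_gauge_cvg0].
by apply: continuous_in_subspaceT => x; rewrite inE; exact: slow_gauge_continuous.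
Qed.

End SlowGauge.

(** * Hausdorff measures of sets of positive and of zero Lebesgue measure *)

Section Hausdorff.
Context {R : realType}.
Implicit Types (f : R -> R) (A : set R).

Lemma hausdorff_content_anti f A (rho rho' : R) : rho <= rho' ->
  (hausdorff_content f rho' A <= hausdorff_content f rho A)%E.
Proof.
move=> rr'; apply: ereal_inf_le_tmp => _ [D [c [r [[rD AD] ->]]]].
exists D, c, r; split=> //; split=> // i /rD/andP[-> rr] /=.
exact: le_trans rr'.
Qed.

Lemma hausdorff_measureE f A : hausdorff_measure f A =
  ereal_sup [set hausdorff_content f rho A | rho in [set` `]0, +oo[]].
Proof.
apply/cvg_lim => //; apply: (@nonincreasing_at_right_cvge _ _ 0 +oo%O) => //.
by move=> x y _ _; exact: hausdorff_content_anti.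
Qed.

Lemma hausdorff_measure_le f A M :
  (forall rho, 0 < rho -> (hausdorff_content f rho A <= M)%E) ->
  (hausdorff_measure f A <= M)%E.
Proof.
move=> fM; rewrite hausdorff_measureE; apply: ge_ereal_sup => _ [rho + <-].
by rewrite /= in_itv/= andbT => /fM.
Qed.

Lemma lebesgue_measure_cover_le A (D : set nat) (c r : nat -> R) :
  measurable A -> (forall i, D i -> 0 < r i) ->
  A `<=` \bigcup_(i in D) `]c i - r i, c i + r i[%classic ->
  (lebesgue_measure A <= \sum_(i <oo | i \in D) (r i *+ 2)%:E)%E.
Proof.
move=> mA r0 AD.
pose F i := if i \in D then `]c i - r i, c i + r i[%classic : set R else set0.
have mF i : measurable (F i) by rewrite /F; case: ifP.
have : (lebesgue_measure A <= \sum_(i <oo) lebesgue_measure (F i))%E.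
  apply: measure_sigma_subadditive => // x /AD[i Di xi]; exists i => //.
  by rewrite /F mem_set.
move=> /le_trans; apply.
rewrite [leRHS]eseries_mkcond; apply: lee_nneseries => // i _.
rewrite /F; have [iD|_] := boolP (i \in D); last by rewrite measure0.
have ri : 0 < r i by apply: r0; rewrite inE in iD.
rewrite lebesgue_measure_itv/= lte_fin ltrD2l gtrN// -EFinB lee_fin mulr2n.
by rewrite opprB addrC addrA subrK.
Qed.

Lemma hausdorff_measure_pinfty f A : measurable A ->
  (0 < lebesgue_measure A)%E -> r^-1 * f r @[r --> 0^'+] --> +oo ->
  hausdorff_measure f A = +oo%E.
Proof.
move=> mA A0 fy; apply/eqyP => M M0.
have [m m0 mA'] : exists2 m : R, 0 < m & (m%:E <= lebesgue_measure A)%E.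
  move: A0; case: (lebesgue_measure A) => [m|_|//]; first by rewrite lte_fin; exists m.
  by exists 1 => //; rewrite leey.
(* The intervals of a cover have lengths [2 * r i] with sum at least m, so [f r >= K * r] makes the
   f-sum at least [K / 2 * m = M]. *)
pose K := M * 2 / m.
have K0 : 0 < K by rewrite divr_gt0 ?mulr_gt0.
have Km : K / 2 * m = M by rewrite /K; field; rewrite gt_eqF.
clearbody K.
have [rho rho0 fK] : exists2 rho, 0 < rho & forall r, 0 < r <= rho -> K * r <= f r.
  have /cvgryPge/(_ K) [e /= e0 eK] := fy.
  exists (e / 2) => [|r /andP[r0 re]]; first exact: divr_gt0.
  rewrite mulrC -ler_pdivlMl//; apply: eK => //=.
  by rewrite sub0r normrN gtr0_norm//; lra.
rewrite hausdorff_measureE.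
apply: (@le_trans _ _ (hausdorff_content f rho A)); last first.
  by apply: ereal_sup_ubound; exists rho => //=; rewrite in_itv/= rho0.
apply: le_ereal_inf_tmp => _ [D [c [r [[rD AD] ->]]]].
have r0 i : D i -> 0 < r i by move=> /rD/andP[].
have ffD i : D i -> (K / 2 * (r i *+ 2) <= f (r i)).
  by move=> /rD/fK fKi; rewrite [r i *+ 2]mulr2n; lra.
have f0 i : D i -> (0 <= (f (r i))%:E)%E.
  move=> Di; rewrite lee_fin; apply: le_trans (ffD _ Di).
  by rewrite mulr_ge0 ?divr_ge0 ?mulrn_wge0 ?(ltW K0) ?ltW ?r0.
have -> : D = [set i | i \in D] by apply/seteqP; split=> i /=; rewrite inE.
rewrite -nneseries_esum; last by move=> i; rewrite inE; exact: f0.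
apply: (@le_trans _ _ (\sum_(i <oo | i \in D) ((K / 2)%:E * (r i *+ 2)%:E))%E); last first.
  apply: lee_nneseries => i; first by rewrite inE => _ Di;
    rewrite -EFinM lee_fin mulr_ge0 ?divr_ge0 ?mulrn_wge0 ?(ltW K0) ?ltW ?r0.
  by rewrite inE => /ffD; rewrite -EFinM lee_fin.
rewrite nneseriesZl; last by move=> i; rewrite inE => Di; rewrite lee_fin mulrn_wge0// ltW// r0.
apply: (@le_trans _ _ ((K / 2)%:E * m%:E)%E).
  by rewrite -EFinM lee_fin Km.
rewrite lee_pmul2l ?lte_fin ?divr_gt0//.
exact: le_trans mA' (lebesgue_measure_cover_le A D c r mA r0 AD).
Qed.

(** The outer measure provides half-open intervals of total length below [e / 2]. Each lies in an
    open interval centred at its left end with radius slightly above its length; the excess radii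
    sum to at most [e / 2] and keep the radius positive for empty intervals. *)
Lemma null_cover A (e : R) : lebesgue_measure A = 0%E -> 0 < e ->
  exists c r : nat -> R, [/\ forall i, 0 < r i,
    A `<=` \bigcup_i `]c i - r i, c i + r i[%classic
    & (\sum_(i <oo) (r i)%:E <= e%:E)%E].
Proof.
move=> A0 e0.
have e20 : 0 < e / 2 by exact: divr_gt0.
have : (lebesgue_measure A < (e / 2)%:E)%E by rewrite A0 lte_fin.
rewrite /lebesgue_measure/= /lebesgue_stieltjes_measure /measure_extension /mu_ext.
move=> /ereal_inf_lt[_ [F [mF AF] <-] Fe].
have [I IE] : {I : nat -> R * R & forall k, `](I k).1, (I k).2]%classic = F k}.
  apply: (@choice _ _ (fun k x => `]x.1, x.2]%classic = F k)) => k.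
  by have [x _ <-] := mF k; exists x.
pose L i := Num.max 0 ((I i).2 - (I i).1).
have LE i : wlength idfun (F i) = (L i)%:E.
  rewrite -IE wlength_itv/= lte_fin -EFinB /L.
  case: ltP => ab; first by rewrite max_r// subr_ge0 ltW.
  by rewrite max_l// subr_le0.
have L0 i : 0 <= L i by rewrite le_max lexx.
exists (fun i => (I i).1), (fun i => L i + e / 2 / (2 ^ i.+1)%:R); split.
- by move=> i; rewrite ltr_wpDl// divr_gt0// ltr0n expn_gt0.
- move=> x /AF[i _]; rewrite -IE/= in_itv/= => /andP[ax xb]; exists i => //=.
  have : (I i).2 - (I i).1 <= L i by rewrite le_max lexx orbT.
  have : 0 < e / 2 / (2 ^ i.+1)%:R by rewrite divr_gt0// ltr0n expn_gt0.
  by move=> ? ?; rewrite in_itv/=; apply/andP; split; lra.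
- under eq_eseriesr do rewrite EFinD -LE.
  have wl0 i : (0 <= wlength idfun (F i))%E by rewrite LE lee_fin.
  apply: (le_trans (epsilon_trick xpredT wl0 (ltW e20))).
  by rewrite [in leRHS](splitr e) EFinD leeD2r// ltW.
Qed.

Let dyadic (n : nat) : R := 1 / (2 ^ n.+1)%:R.

Let dyadic_gt0 n : 0 < dyadic n.
Proof. by rewrite divr_gt0// ltr0n expn_gt0. Qed.

Let dyadic_sum : (\sum_(n <oo) (dyadic n)%:E <= 1)%E.
Proof. exact: epsilon_trick0. Qed.

Let dyadic_decr m n : (m <= n)%N -> dyadic n <= dyadic m.
Proof.
by move=> mn; rewrite ler_pM2l// lef_pV2 ?posrE ?ltr0n ?expn_gt0// ler_nat leq_pexp2l.
Qed.

(* [A] has covers [r k] of total length at most [2^-(k+1)]; the scales [s l] are chosen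
   so small that each of the first [l] covers satisfies
   [sum_i min (r k i) (s l) <= 2^-(l+1)]. *)
Lemma null_set_gauge A : lebesgue_measure A = 0%E ->
  exists f, [/\ dimension_function f,
    forall r s, 0 < r -> r < s -> s^-1 * f s < r^-1 * f r,
    r^-1 * f r @[r --> 0^'+] --> +oo
    & hausdorff_measure f A != +oo%E].
Proof.
move=> A0.
have [C CE] : {C : nat -> (nat -> R) * (nat -> R) & forall k, [/\ forall i, 0 < (C k).2 i,
    A `<=` \bigcup_i `](C k).1 i - (C k).2 i, (C k).1 i + (C k).2 i[%classic
    & (\sum_(i <oo) ((C k).2 i)%:E <= (dyadic k)%:E)%E]}.
  apply: (@choice _ _ (fun k C => [/\ forall i, 0 < C.2 i,
    A `<=` \bigcup_i `]C.1 i - C.2 i, C.1 i + C.2 i[%classic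
    & (\sum_(i <oo) (C.2 i)%:E <= (dyadic k)%:E)%E])) => k.
  by have [c [r H]] := null_cover _ _ A0 (dyadic_gt0 k); exists (c, r).
have C0 k i : 0 < (C k).2 i by have [] := CE k.
have Cle k : (\sum_(i <oo) ((C k).2 i)%:E <= (dyadic k)%:E)%E by have [] := CE k.
have [s sE] : {s : nat -> R & forall l, [/\ 0 < s l, s l <= dyadic l &
    forall k, (k < l)%N -> (\sum_(i <oo) (Num.min ((C k).2 i) (s l))%:E <= (dyadic l)%:E)%E]}.
  apply: (@choice _ _ (fun l t => [/\ 0 < t, t <= dyadic l &
    forall k, (k < l)%N -> (\sum_(i <oo) (Num.min ((C k).2 i) t)%:E <= (dyadic l)%:E)%E])) => l.
  (* One t serves all [k < l]; stating the bound for every smaller u lets the induction take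
     minima. *)
  have [t t0 tl] : exists2 t, 0 < t & forall k, (k < l)%N -> forall u, 0 < u <= t ->
        (\sum_(i <oo) (Num.min ((C k).2 i) u)%:E <= (dyadic l)%:E)%E.
    move: (dyadic l) (dyadic_gt0 l) => e e0.
    elim: l => [|m [t t0 tm]]; first by exists 1.
    have [t' t'0 t'm] := nneseries_min_small _ _ (fun i => ltW (C0 m i))
      (le_lt_trans (Cle m) (ltry _)) e0.
    exists (Num.min t t'); first by rewrite lt_min t0.
    move=> k; rewrite ltnS leq_eqVlt => /orP[/eqP ->|km] u; rewrite le_min => /and3P[u0 ut ut'].
      by apply: t'm; rewrite ltW.
    by apply: tm => //; rewrite u0.
  exists (Num.min t (dyadic l)); split=> [| |k kl]; rewrite ?lt_min ?t0 ?dyadic_gt0 ?ge_min ?lexx ?orbT//.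
  by apply: tl => //; rewrite lt_min t0 dyadic_gt0 ge_min lexx.
have s0 l : 0 < s l by have [] := sE l.
have soo : (\sum_(l <oo) (s l)%:E < +oo)%E.
  apply: (@le_lt_trans _ _ 1%E); last exact: ltry.
  apply: le_trans dyadic_sum; apply: lee_nneseries => l _; first by rewrite lee_fin ltW.
  by rewrite lee_fin; have [] := sE l.
exists (slow_gauge s); split.
- exact: dimension_function_slow_gauge.
- exact: slow_gauge_ratio_decr.
- exact: slow_gauge_ratio_cvgy.
rewrite -ltey; apply: (@le_lt_trans _ _ 1%E); last exact: ltry.
apply: hausdorff_measure_le => rho rho0.
(* The cover of index k is a rho-cover: each radius is at most the sum of all of them, hence at most
   [dyadic k]. *)
have [k krho] : exists k, dyadic k <= rho.
  have [n nr] : exists n, rho^-1 <= n%:R :> R.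
    by exists (Num.trunc rho^-1).+1; exact/ltW/truncnS_gt.
  exists n; rewrite /dyadic div1r -[rho]invrK lef_pV2 ?posrE ?invr_gt0 ?ltr0n ?expn_gt0//.
  by apply: (le_trans nr); rewrite ler_nat ltnW// (ltn_trans (ltnSn n))// ltn_expl.
have [_ AC _] := CE k.
apply: (@le_trans _ _ (\esum_(i in setT) (slow_gauge s ((C k).2 i))%:E)).
  apply: ereal_inf_lbound; exists setT, (C k).1, (C k).2; split=> //; split=> // i _.
  rewrite C0/=; apply: le_trans krho; rewrite -lee_fin; apply: le_trans (Cle k).
  have Ck0 j : (0 <= ((C k).2 j)%:E)%E by rewrite lee_fin ltW.
  by rewrite (nneseriesD1 (n:=i))// leeDl// nneseries_ge0.
rewrite -nneseries_esumT; last by move=> i; rewrite lee_fin ltW// slow_gauge_gt0.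
under eq_eseriesr do rewrite slow_gaugeE//.
have h0 i l : (0 <= ((C k).2 i * s l / ((C k).2 i + s l))%:E)%E.
  by rewrite lee_fin hyperbola_ge0// ltW.
rewrite nneseries_interchange//; apply: le_trans dyadic_sum; apply: lee_nneseries => l _.
  by move=> _; apply: nneseries_ge0.
(* For [l > k] the choice of [s l] bounds the sum over i by [dyadic l]. For [l <= k] the sum of the
   radii does, being at most [dyadic k <= dyadic l]. The double sum is thus at most 1, whatever rho
   is. *)
have [kl|lk] := ltnP k l.
- have [_ _ /(_ k kl)] := sE l; apply: le_trans; apply: lee_nneseries => // i _.
  by rewrite lee_fin hyperbola_le_min.
- apply: (@le_trans _ _ (dyadic k)%:E); last by rewrite lee_fin dyadic_decr.
  apply: le_trans (Cle k); apply: lee_nneseries => // i _.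
  by rewrite lee_fin (le_trans (hyperbola_le_min _ _ _ _))// ge_min lexx.
Qed.

End Hausdorff.

(** * Zero-one laws on the line *)

Section ZeroOne.
Context {R : realType}.
Implicit Types A B C : set R.
Local Notation mu := (@lebesgue_measure R).

Lemma measurable_fun_affine (L c : R) :
  measurable_fun setT (fun x : measurableTypeR R => L * x + c : measurableTypeR R).
Proof. by apply: measurable_funD => //; exact: measurable_funM. Qed.

Lemma measurable_affine_preimage (L c : R) B : measurable B ->
  measurable ((fun x => L * x + c) @^-1` B).
Proof.
by move=> mB; rewrite -[X in measurable X]setTI; exact: measurable_fun_affine.
Qed.

(** By uniqueness of Lebesgue measure: the pushforward scaled by L gives half-open intervals their
    length. *)
Lemma lebesgue_measure_affine_preimage (L c : R) B : 0 < L -> measurable B ->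
  mu ((fun x => L * x + c) @^-1` B) = (L^-1%:E * mu B)%E.
Proof.
move=> L0 mB; have L0' : 0 <= L by exact: ltW.
pose f := fun x : measurableTypeR R => L * x + c : measurableTypeR R.
have muE : mu B = pushforward (mscale (NngNum L0') mu) f B.
  apply: lebesgue_measure_unique => //=; first exact: measurable_fun_affine.
  move=> mf _ [[a b] _ <-] /=.
  rewrite /mscale/= /pushforward/=.
  have -> : f @^-1` `]a, b] = `](a - c) / L, (b - c) / L]%classic.
    apply/seteqP; split=> x /=; rewrite /f !in_itv/= ltr_pdivrMr// ler_pdivlMr// => /andP[? ?];
    by apply/andP; split; lra.
  rewrite !lebesgue_measure_itv/= !lte_fin ltr_pM2r ?invr_gt0// ltrD2r.
  case: ifP => _; rewrite ?mule0// -!EFinB -EFinM; congr EFin.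
  by field; rewrite gt_eqF.
rewrite muE /mscale/= /pushforward muleA -EFinM mulVf ?mul1e// gt_eqF//.
Qed.

Lemma lebesgue_measure_translate (c : R) B : measurable B ->
  mu ((fun x => x + c) @^-1` B) = mu B.
Proof.
move=> mB; have := lebesgue_measure_affine_preimage 1 c B ltr01 mB.
rewrite invr1 mul1e => <-; congr (mu _).
by apply/seteqP; split=> x /=; rewrite mul1r.
Qed.

(** Whole periods reduce x to some y in [[0, h[]; then [[y, y + h[] is cut at h and its second part
    shifted back to [[0, y[]. *)
Lemma periodic_interval_measure A (h x : R) : measurable A -> 0 < h ->
  (forall (k : int) y, A y -> A (y + k%:~R * h)) ->
  mu (A `&` `[x, x + h[) = mu (A `&` `[0, h[).
Proof.
move=> mA h0 Ah.
pose k := Num.floor (x / h); pose y := x - k%:~R * h.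
have y0 : 0 <= y by rewrite subr_ge0 -ler_pdivlMr// floor_le_tmp.
have yh : y < h.
  by rewrite ltrBlDr -[X in _ < X + _]mul1r -mulrDl -ltr_pdivrMr// addrC -intrD1 floorD1_gt.
have shift (j : int) a b : mu (A `&` `[a + j%:~R * h, b + j%:~R * h[) = mu (A `&` `[a, b[).
  rewrite -[LHS](lebesgue_measure_translate (j%:~R * h)); last exact: measurableI.
  congr (mu _); apply/seteqP; split=> z /= [Az]; rewrite !in_itv/= lerD2r ltrD2r => zab.
    by split=> //; have := Ah (- j) _ Az; rewrite mulrNz mulNr addrK.
  by split=> //; exact: Ah.
have split_itv a b c : a <= b -> b <= c ->
    mu (A `&` `[a, c[) = (mu (A `&` `[a, b[) + mu (A `&` `[b, c[))%E.
  move=> ab bc; rewrite -measureU//; try exact: measurableI; last first.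
    apply/seteqP; split=> // z /= [[_]]; rewrite !in_itv/= => /andP[_ zb] [_ /andP[bz _]].
    by move: (lt_le_trans zb bz); rewrite ltxx.
  congr (mu _); rewrite -setIUr; congr (_ `&` _).
  apply/seteqP; split=> z /=; rewrite !in_itv/=.
    by move=> /andP[az zc]; case: (ltP z b) => zb; [left|right]; rewrite ?az ?zb ?zc.
  case=> /andP[az zc]; first by rewrite az (lt_le_trans zc).
  by rewrite (le_trans ab) ?zc.
have -> : x = y + k%:~R * h by rewrite /y subrK.
clearbody y k; clear x.
rewrite addrAC shift (split_itv _ h)//; [|exact: ltW|by rewrite lerDr].
rewrite [RHS](split_itv _ y)//; last exact: ltW.
rewrite addeC; congr (_ + _)%E.
by have := shift 1 0 y; rewrite mul1r add0r => <-.
Qed.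

(** At a density point the proportion of A in small balls tends to 1, yet arbitrarily small balls
    carry at most the proportion m that A has in the unit interval. This excludes [m < 1]. *)
Lemma density_full A : measurable A -> (0 < mu (A `&` `[0%R, 1%R[))%E ->
  (forall e, 0 < e -> exists2 rho, 0 < rho < e & forall x,
    (mu (A `&` ball x rho) <= (rho *+ 2)%:E * mu (A `&` `[0%R, 1%R[))%E) ->
  (1 <= mu (A `&` `[0%R, 1%R[))%E.
Proof.
move=> mA A0 Arho; rewrite leNgt; apply/negP => A1.
pose m := fine (mu (A `&` `[0%R, 1%R[)).
have mE : mu (A `&` `[0%R, 1%R[) = m%:E.
  by rewrite fineK// ge0_fin_numE//; exact: lt_trans (ltry 1).
have m1 : m < 1 by rewrite -lte_fin -mE.
have [x [Ax xdens]] : exists x, A x /\ (mu (A `&` ball x r) * (mu (ball x r))^-1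
    @[r --> 0^'+] --> 1)%E.
  have [N [mN N0 sub]] := lebesgue_density mA.
  apply: contrapT => /forallNP nx.
  have AN : A `&` `[0%R, 1%R[ `<=` N.
    move=> x [Ax _]; apply: sub => /= H; apply: (nx x); split=> //.
    by move: H; rewrite indicE mem_set.
  have : (mu (A `&` `[0%R, 1%R[) <= mu N)%E.
    by apply: le_measure => //; rewrite inE//; exact: measurableI.
  by rewrite N0 leNgt A0.
have [e /= e0 He] : \forall r \near 0^'+, (m%:E < mu (A `&` ball x r) * (mu (ball x r))^-1)%E.
  by have /= := xdens _ (open_ereal_gt' (y:=m%:E) (x:=1%E) _); rewrite lte_fin; apply.
have [rho /andP[rho0 rhoe] /(_ x)] := Arho e e0.
have := He rho; rewrite /= sub0r normrN gtr0_norm// => /(_ rhoe rho0).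
have rho20 : 0 < rho *+ 2 by rewrite mulrn_wgt0.
rewrite mE lebesgue_measure_ball ?(ltW rho0)// inver gt_eqF// => H1 H2.
have : (m%:E < m%:E)%E; last by rewrite ltxx.
by apply: (lt_le_trans H1); rewrite lee_pdivrMr// muleC.
Qed.

(** The n-th iterate [y -> p ^ n * y + c] maps A into itself and blows a ball of length [p ^ -n] up
    to a unit interval, where periodicity fixes the measure of A. Hence A fills no larger proportion
    of the ball than of the unit interval. *)
Lemma expanding_full A (p : nat) (b : R) : measurable A ->
  (forall (k : int) y, A y -> A (y + k%:~R)) ->
  (1 < p)%N -> (forall y, A y -> A (p%:R * y + b)) ->
  (0 < mu (A `&` `[0%R, 1%R[))%E -> (1 <= mu (A `&` `[0%R, 1%R[))%E.
Proof.
move=> mA A1 p1 Ap A0; apply: density_full => // e e0.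
have iter_affine k : exists c, forall y, A y -> A (p%:R ^+ k * y + c).
  elim: k => [|k [c Ac]]; first by exists 0 => y Ay; rewrite expr0 mul1r addr0.
  exists (p%:R * c + b) => y /Ac/Ap; congr A.
  by rewrite exprS mulrDr mulrA addrA.
have [n en] : exists n : nat, e^-1 <= n%:R.
  by exists (Num.trunc e^-1).+1; exact/ltW/truncnS_gt.
have p0 k : 0 < p%:R ^+ k :> R by rewrite exprn_gt0// ltr0n ltnW.
have ne : (p%:R ^+ n)^-1 <= e.
  rewrite -[e]invrK lef_pV2 ?posrE ?invr_gt0//; apply: (le_trans en).
  by rewrite -natrX ler_nat ltnW// ltn_expl.
have [c Ac] := iter_affine n; move: (p0 n) ne Ac; set L := p%:R ^+ n => L0 ne Ac.
have Li0 : 0 < L^-1 by rewrite invr_gt0.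
exists (L^-1 / 2) => [|x]; first by rewrite divr_gt0//=; lra.
have -> : L^-1 / 2 *+ 2 = L^-1 by rewrite -mulr_natr divfK.
pose z := L * (x - L^-1 / 2) + c.
have Az : mu (A `&` `[z, z + 1[) = mu (A `&` `[0%R, 1%R[).
  by apply: periodic_interval_measure => // k y /A1; rewrite mulr1.
rewrite -Az -(lebesgue_measure_affine_preimage L c)//; last exact: measurableI.
apply: le_measure; rewrite ?inE.
- by apply: measurableI => //; exact: measurable_ball.
- by apply: measurable_affine_preimage; exact: measurableI.
- move=> y [Ay]; rewrite ball_itv/= in_itv/= => /andP[xy yx]; split; first exact: Ac.
  have LL : L * L^-1 = 1 by rewrite divff// gt_eqF.
  rewrite /z /= in_itv/= lerD2r ler_pM2l// ltW//=.
  have : L * y < L * (x + L^-1 / 2) by rewrite ltr_pM2l.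
  by rewrite !mulrDr mulrN mulrA LL; lra.
Qed.

Lemma periodic_prefix_measure A (h : R) (n : nat) : measurable A -> 0 < h ->
  (forall (k : int) y, A y -> A (y + k%:~R * h)) ->
  mu (A `&` `[0, n%:R * h[) = (n%:R%:E * mu (A `&` `[0%R, h[))%E.
Proof.
move=> mA h0 Ah; elim: n => [|n IH].
  by rewrite mul0r mul0e set_itv_ge ?bnd_simp ?ltxx// setI0 measure0.
have -> : A `&` `[0, n.+1%:R * h[ =
    (A `&` `[0, n%:R * h[) `|` (A `&` `[n%:R * h, n%:R * h + h[).
  have nh : 0 <= n%:R * h by rewrite mulr_ge0// ltW.
  rewrite -setIUr -natr1 mulrDl mul1r; congr (_ `&` _).
  apply/seteqP; split=> z /=; rewrite !in_itv/=.
    by move=> /andP[az zc]; case: (ltP z (n%:R * h)) => zb; [left|right]; rewrite ?az ?zb ?zc.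
  case=> /andP[az zc]; first by rewrite az (lt_le_trans zc)// lerDl ltW.
  by rewrite (le_trans nh) ?zc.
rewrite measureU//; try exact: measurableI; last first.
  apply/seteqP; split=> // z /= [[_]]; rewrite !in_itv/= => /andP[_ zb] [_ /andP[bz _]].
  by move: (lt_le_trans zb bz); rewrite ltxx.
rewrite /= IH periodic_interval_measure// -natr1 EFinD ge0_muleDl ?lee_fin//.
by rewrite mul1e.
Qed.

(** A ball of length [1 / p] spans one period of C, so C has the same proportion in it as in the
    unit interval. A need agree with C only up to a null set, which the equality over all B
    encodes. *)
Lemma fine_periods_full A : measurable A ->
  (forall e : R, 0 < e -> exists p : nat, [/\ (0 < p)%N, p%:R^-1 < e &
    exists2 C : set R, measurable C & (forall (k : int) y, C y -> C (y + k%:~R / p%:R)) /\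
      forall B, measurable B -> mu (A `&` B) = mu (C `&` B)]) ->
  (0 < mu (A `&` `[0%R, 1%R[))%E -> (1 <= mu (A `&` `[0%R, 1%R[))%E.
Proof.
move=> mA AC A0; apply: density_full => // e e0.
have [p [p0 pe [C mC [Cp ACE]]]] := AC e e0.
have pR0 : 0 < p%:R :> R by rewrite ltr0n.
have pi0 : 0 < p%:R^-1 :> R by rewrite invr_gt0.
exists (p%:R^-1 / 2) => [|x]; first by rewrite divr_gt0//=; lra.
have -> : p%:R^-1 / 2 *+ 2 = p%:R^-1 :> R by rewrite -mulr_natr divfK.
rewrite !ACE//; last exact: measurable_ball.
have := periodic_prefix_measure C p%:R^-1 p mC pi0 Cp.
rewrite mulfV ?gt_eqF// => ->; rewrite muleA -EFinM mulVf ?gt_eqF// mul1e.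
rewrite -(periodic_interval_measure C p%:R^-1 (x - p%:R^-1 / 2))//.
apply: le_measure; rewrite ?inE.
- by apply: measurableI => //; exact: measurable_ball.
- exact: measurableI.
move=> y [Cy]; rewrite ball_itv/= in_itv/= => /andP[xy yx]; split=> //.
by rewrite /= in_itv/= ltW//=; lra.
Qed.

End ZeroOne.

(** * Rational approximation *)

Section Approximation.
Context {R : realType}.
Local Notation mu := (@lebesgue_measure R).

Lemma coprimez_addMl (m k n : int) : coprimez m n -> coprimez (m + k * n) n.
Proof.
move=> /coprimezP[[u v] /= uv]; apply/coprimezP; exists (u, v - u * k) => /=.
by rewrite -uv; ring.
Qed.

(** The lift to the line of one approximation set, with denominators cleared and m ranging over all
    integers. *)
Definition approximable (c : R) (n : nat) : set R :=
  [set x | exists2 m : int, coprimez m n & `|x * n%:R - m%:~R| < c].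

Lemma approximable_open c n : open (approximable c n).
Proof.
have -> : approximable c n =
    \bigcup_(m in [set m : int | coprimez m n]) ((fun x => x * n%:R) @^-1` ball (m%:~R : R) c).
  by apply/seteqP; split=> x [m cm xm]; exists m => //; move: xm; rewrite /ball/= distrC.
apply: bigcup_open => m _; apply: open_comp; last exact: ball_open.
by move=> x _; exact: mulrr_continuous.
Qed.

Lemma approx_setP (psi : nat -> R) n x : (0 < n)%N ->
  approx_set psi n x <-> (0 <= x < 1) /\ approximable (psi n) n x.
Proof.
move=> n0; have nR0 : 0 < n%:R :> R by rewrite ltr0n.
have itvP m y : (`](m%:R - psi n) / n%:R, (m%:R + psi n) / n%:R[%classic : set R) y <->
    `|y * n%:R - m%:R| < psi n.
  rewrite /= in_itv/= ltr_pdivrMr// ltr_pdivlMr// ltr_norml.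
  by split=> /andP[? ?]; apply/andP; split; lra.
split.
- move=> [m [m0 mn]] [y /itvP ym <-].
  rewrite /mod1; split; first by rewrite subr_ge0 floor_le_tmp ltrBlDl -intrD1 floorD1_gt.
  exists (m%:Z - Num.floor y * n%:Z).
    by rewrite -mulNr coprimez_addMl// coprimezE.
  rewrite intrD rmorphN/= intrM -!pmulrn mulrBl opprB addrA subrK.
  by [].
- move=> [/andP[x0 x1] [m cm xm]].
  (* Dividing [m - 1] instead of m puts the reduced numerator [r + 1] in the range from 1 to n. *)
  pose q := ((m - 1) %/ n%:Z)%Z; pose r := ((m - 1) %% n%:Z)%Z.
  have mE : m = q * n%:Z + r + 1 by rewrite -divz_eq subrK.
  have r0 : 0 <= r by rewrite modz_ge0// lt0n_neq0.
  have rn : r < n%:Z by rewrite ltz_pmod.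
  exists (absz r).+1.
    have -> : (absz r).+1 = absz (m - q * n%:Z)%R by lia.
    split; first by rewrite /=; lia.
    by have := coprimez_addMl m (- q) n cm; rewrite mulNr coprimezE.
  exists (x - q%:~R).
    apply/itvP.
    move: xm; congr (`|_| < _).
    have -> : (absz r).+1%:R = (r + 1)%:~R :> R.
      by rewrite -{2}(gez0_abs r0) -natr1 intrD -pmulrn.
    rewrite {1}mE !intrD intrM -pmulrn; ring.
  have fl : Num.floor (x - q%:~R) = - q.
    by apply: floor_def; rewrite intrD rmorphN/=; apply/andP; split; lra.
  by rewrite /mod1 fl rmorphN/= opprK subrK.
Qed.

Definition dilated_limsup (psi : nat -> R) (Q : set nat) : set R :=
  [set x | exists M : nat, forall N, exists n,
    [/\ (N <= n)%N, (0 < n)%N, Q n & approximable (M%:R * psi n) n x]].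

Lemma measurable_dilated_limsup psi Q : measurable (dilated_limsup psi Q).
Proof.
have -> : dilated_limsup psi Q = \bigcup_M \bigcap_N
    \bigcup_(n in [set n | [/\ (N <= n)%N, (0 < n)%N & Q n]]) approximable (M%:R * psi n) n.
  apply/seteqP; split=> x [M].
    by move=> xM; exists M => // N _; have [n [? ? ? ?]] := xM N; exists n.
  by move=> _ xM; exists M => N; have [n [? ? ?] ?] := xM N I; exists n.
apply: bigcupT_measurable => M; apply: bigcapT_measurable => N.
by apply: open_measurable; apply: bigcup_open => n _; exact: approximable_open.
Qed.

Lemma dilated_limsup_sub psi Q Q' : Q `<=` Q' ->
  dilated_limsup psi Q `<=` dilated_limsup psi Q'.
Proof.
move=> QQ' x [M xM]; exists M => N; have [n [? ? /QQ' ? ?]] := xM N.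
by exists n.
Qed.

(** Pigeonhole at a fixed M: infinitely many n in the union leave infinitely many in one of the two
    sets. *)
Lemma dilated_limsupU psi Q Q' :
  dilated_limsup psi (Q `|` Q') = dilated_limsup psi Q `|` dilated_limsup psi Q'.
Proof.
apply/seteqP; split; last first.
  by move=> x [|]; apply: dilated_limsup_sub => n; [left|right].
move=> x [M xM]; apply: contrapT => /not_orP[nQ nQ'].
have /existsNP[N nN] : ~ forall N, exists n,
    [/\ (N <= n)%N, (0 < n)%N, Q n & approximable (M%:R * psi n) n x].
  by move=> H; apply: nQ; exists M.
have /existsNP[N' nN'] : ~ forall N, exists n,
    [/\ (N <= n)%N, (0 < n)%N, Q' n & approximable (M%:R * psi n) n x].
  by move=> H; apply: nQ'; exists M.
have [n [Nn n0 [Qn|Qn] xn]] := xM (maxn N N').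
  by apply: nN; exists n; split=> //; apply: leq_trans Nn; exact: leq_maxl.
by apply: nN'; exists n; split=> //; apply: leq_trans Nn; exact: leq_maxr.
Qed.

(** An error enlarged k times is absorbed by replacing M with [k * M]. *)
Lemma dilated_limsup_map psi Q (k : nat) (T : R -> R) :
  (forall c n x, (0 < n)%N -> Q n -> approximable c n x -> approximable (k%:R * c) n (T x)) ->
  forall x, dilated_limsup psi Q x -> dilated_limsup psi Q (T x).
Proof.
move=> QT x [M xM]; exists (k * M)%N => N; have [n [? ? Qn xn]] := xM N.
by exists n; split=> //; rewrite natrM -mulrA; exact: QT.
Qed.

Lemma dilated_limsup_periodic psi Q (k : int) x :
  dilated_limsup psi Q x -> dilated_limsup psi Q (x + k%:~R).
Proof.
apply: (@dilated_limsup_map _ _ 1 (fun x => x + k%:~R)) => c n {}x n0 _ [m cm xm].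
exists (m + k * n%:Z); last first.
  by move: xm; rewrite mul1r intrD intrM -pmulrn mulrDl opprD addrACA subrr addr0.
exact: coprimez_addMl.
Qed.

(** * Symmetries attached to a prime *)

Section Prime.
Variable p : nat.
Hypothesis pp : prime p.

(** The numerator m becomes [p * m], still coprime to n since p does not divide n. *)
Lemma dilated_limsup_coprime_map psi x :
  dilated_limsup psi [set n | ~~ (p %| n)%N] x ->
  dilated_limsup psi [set n | ~~ (p %| n)%N] (p%:R * x).
Proof.
apply: (dilated_limsup_map _ _ p) => c n {}x n0 /= pn [m cm xm].
exists (p%:Z * m).
  by rewrite coprimezMl cm andbT coprimezE/= prime_coprime.
rewrite intrM -pmulrn -mulrA -mulrBr normrM ger0_norm//.
by rewrite ltr_pM2l// ltr0n prime_gt0.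
Qed.

(** Write [n = q * p] with q prime to p. The shift [1 / p] turns the numerator into [p * m + q],
    coprime to q because [p * m] is, and to p because q is. *)
Lemma dilated_limsup_exact_map psi x :
  dilated_limsup psi [set n | (p %| n)%N && ~~ (p ^ 2 %| n)%N] x ->
  dilated_limsup psi [set n | (p %| n)%N && ~~ (p ^ 2 %| n)%N] (p%:R * x + p%:R^-1).
Proof.
have p0 : 0 < p%:R :> R by rewrite ltr0n prime_gt0.
apply: (dilated_limsup_map _ _ p (fun x => p%:R * x + p%:R^-1))
  => c n {}x n0 /= /andP[/dvdnP[q ->] pq] [m cm xm].
exists (p%:Z * m + q%:Z).
  move: cm; rewrite PoszM !coprimezMr => /andP[mq mp].
  have pq' : coprimez p q.
    by rewrite coprimezE/= prime_coprime//; apply: contra pq => pq; rewrite -mulnn dvdn_mul.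
  apply/andP; split.
    by have := coprimez_addMl (p%:Z * m) 1 q; rewrite mul1r coprimezMl pq' mq; apply.
  by rewrite addrC mulrC coprimez_addMl// coprimez_sym.
have -> : (p%:R * x + p%:R^-1) * (q * p)%:R - (p%:Z * m + q%:Z)%:~R =
    p%:R * (x * (q * p)%:R - m%:~R).
  rewrite intrD intrM -!pmulrn natrM; field; exact: lt0r_neq0.
by rewrite normrM ger0_norm// ltr_pM2l.
Qed.

(** With [n = q * p ^ 2] the numerator moves by a multiple of [q * p], which has the same prime
    factors as n, so coprimality persists. *)
Lemma dilated_limsup_square_periodic psi (k : int) x :
  dilated_limsup psi [set n | (p ^ 2 %| n)%N] x ->
  dilated_limsup psi [set n | (p ^ 2 %| n)%N] (x + k%:~R / p%:R).
Proof.
have p0 : 0 < p%:R :> R by rewrite ltr0n prime_gt0.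
apply: (dilated_limsup_map _ _ 1%N (fun x => x + k%:~R / p%:R))
  => c n {}x n0 /= /dvdnP[q qE] [m cm xm].
exists (m + k * (q * p)%N%:Z).
  move: cm; rewrite qE -mulnn mulnA PoszM !coprimezMr => /andP[mqp _].
  have mkqp := coprimez_addMl m k _ mqp; rewrite mkqp /=.
  by apply: coprimez_dvdr mkqp; exact: dvdn_mull.
rewrite mul1r.
have -> : (x + k%:~R / p%:R) * n%:R - (m + k * (q * p)%N%:Z)%:~R = x * n%:R - m%:~R.
  rewrite intrD intrM -!pmulrn qE !natrM; field; exact: lt0r_neq0.
by [].
Qed.

End Prime.

Lemma dilated_limsup_prime_split (p : nat) psi : dilated_limsup psi setT =
  dilated_limsup psi [set n | ~~ (p %| n)%N] `|`
  dilated_limsup psi [set n | (p %| n)%N && ~~ (p ^ 2 %| n)%N] `|`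
  dilated_limsup psi [set n | (p ^ 2 %| n)%N].
Proof.
rewrite -!dilated_limsupU; congr (dilated_limsup psi _); apply/seteqP; split=> // n _ /=.
have [pn|pn] := boolP (p %| n)%N; last by left; left.
by have [ppn|ppn] := boolP (p ^ 2 %| n)%N; [right|left; right].
Qed.

Lemma periodic_null (A : set R) : measurable A ->
  (forall (k : int) y, A y -> A (y + k%:~R)) ->
  mu (A `&` `[0%R, 1%R[) = 0%E -> mu A = 0%E.
Proof.
move=> mA A1 A0.
have nullI a : mu.-negligible (A `&` `[a, a + 1[).
  apply/negligibleP; first exact: measurableI.
  apply: etrans A0; apply: periodic_interval_measure => // k y.
  by move=> /A1; rewrite mulr1.
have neg : mu.-negligible (\bigcup_(n : nat) (A `&` `[n%:R, n%:R + 1[) `|`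
    \bigcup_(n : nat) (A `&` `[- n%:R, - n%:R + 1[)).
  by apply: negligibleU; apply: negligible_bigcup.
apply: measure_negligible => //; apply: negligibleS neg => x Ax.
have := floor_le_tmp x; have := floorD1_gt x; rewrite intrD.
case: (intP (Num.floor x)) => [|n|n] x1 x2.
- by left; exists 0%N => //; split=> //=; rewrite in_itv/= x1 x2.
- by left; exists n.+1 => //; split=> //=; rewrite in_itv/= x1 x2.
- by right; exists n.+1 => //; split=> //=; move: x1 x2; rewrite in_itv/= mulrNz => -> ->.
Qed.

(* Gallagher's argument: if for some prime p the denominators not divisible by
   p^2 contribute positive measure, an expanding affine map finishes; otherwise
   the set is almost everywhere 1/p-periodic for every p. *)
Lemma dilated_limsup_full psi : (0 < mu (dilated_limsup psi setT `&` `[0%R, 1%R[))%E ->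
  (1 <= mu (dilated_limsup psi setT `&` `[0%R, 1%R[))%E.
Proof.
move=> V0; set V := dilated_limsup psi setT in V0 *.
have mD Q : measurable (dilated_limsup psi Q) by exact: measurable_dilated_limsup.
have mDI Q : measurable (dilated_limsup psi Q `&` `[0, 1[) by exact: measurableI.
have subV Q : (1 <= mu (dilated_limsup psi Q `&` `[0%R, 1%R[) ->
    1 <= mu (V `&` `[0%R, 1%R[))%E.
  move=> /le_trans; apply; apply: le_measure; rewrite ?inE; [exact: mDI|exact: mDI|].
  by apply: setSI; exact: dilated_limsup_sub.
have [pos|] := pselect (exists2 p, prime p &
  (0 < mu (dilated_limsup psi [set n | ~~ (p %| n)%N] `&` `[0%R, 1%R[))%E \/
  (0 < mu (dilated_limsup psi [set n | (p %| n)%N && ~~ (p ^ 2 %| n)%N] `&` `[0%R, 1%R[))%E).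
  case: pos => p pp [/expanding_full pos|/expanding_full pos].
  - apply: subV; apply: (pos p 0) => //.
    + by move=> k y; exact: dilated_limsup_periodic.
    + exact: prime_gt1.
    + by move=> y; rewrite addr0; exact: dilated_limsup_coprime_map.
  - apply: subV; apply: (pos p p%:R^-1) => //.
    + by move=> k y; exact: dilated_limsup_periodic.
    + exact: prime_gt1.
    + by move=> y; exact: dilated_limsup_exact_map.
move=> /forall2NP nopos; apply: (fine_periods_full V (mD _) _ V0) => e e0.
have [p pe pp] := prime_above (Num.trunc e^-1).
exists p; split; first exact: prime_gt0.
  rewrite -[e]invrK ltf_pV2 ?posrE ?invr_gt0 ?ltr0n ?prime_gt0//.
  by apply: lt_le_trans (truncnS_gt _) _; rewrite ler_nat.
exists (dilated_limsup psi [set n | (p ^ 2 %| n)%N]); first exact: mD.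
split=> [k y|B mB]; first exact: dilated_limsup_square_periodic.
have [//|/not_orP[A0 B0]] := nopos p.
(* Periodicity spreads nullity from the unit interval to the line, so the two discarded pieces
   affect [mu (V]&[B)] for no B. *)
have null Q : ~ (0 < mu (dilated_limsup psi Q `&` `[0%R, 1%R[))%E -> mu (dilated_limsup psi Q) = 0%E.
  move=> /negP; rewrite -leNgt => D0; apply: periodic_null => //.
    by move=> k z; exact: dilated_limsup_periodic.
  by apply/eqP; rewrite eq_le D0 measure_ge0.
rewrite /V (dilated_limsup_prime_split p psi) setIUl.
set N := (X in (X `&` B) `|` _); have mN : measurable N by exact: measurableU.
have N0 : mu N = 0%E by rewrite /N measureU0; [exact: null A0|exact: mD|exact: mD|exact: null B0].
rewrite setUC measureU0; [by []|by apply: measurableI => //; exact: mD|exact: measurableI|].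
apply/eqP; rewrite eq_le measure_ge0 andbT -N0; apply: le_measure; rewrite ?inE//.
exact: measurableI.
Qed.

End Approximation.

(** * From positive to full measure, and comparison of the two series *)

Section WellApprox.
Context {R : realType}.
Implicit Types psi : nat -> R.
Local Notation mu := (@lebesgue_measure R).

Lemma approx_set0 psi : approx_set psi 0 = set0.
Proof. by apply/seteqP; split=> // x [m [/= /andP[m0 /(leq_trans m0)]]]. Qed.

Lemma measurable_well_approx_set psi : measurable (well_approx_set psi).
Proof.
apply: bigcapT_measurable => N; apply: bigcup_measurable => -[|n] _.
  by rewrite approx_set0.
have -> : approx_set psi n.+1 = `[0, 1[ `&` approximable (psi n.+1) n.+1.
  by apply/seteqP; split=> x; rewrite approx_setP//= in_itv/= => -[].
by apply: measurableI => //; exact: open_measurable (approximable_open _ _).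
Qed.

Lemma well_approx_set_sub psi : well_approx_set psi `<=` `[0, 1[.
Proof.
move=> x /(_ 0%N I)[[|n] _]; first by rewrite approx_set0.
by rewrite approx_setP//= in_itv/= => -[].
Qed.

Lemma lebesgue_measure_unit : mu `[0%R, 1%R[ = 1%E.
Proof. by rewrite lebesgue_measure_itv/= lte01 oppr0 adde0. Qed.

Lemma well_approx_set_le1 psi : (mu (well_approx_set psi) <= 1)%E.
Proof.
rewrite -lebesgue_measure_unit; apply: le_measure; rewrite ?inE//.
- exact: measurable_well_approx_set.
- exact: well_approx_set_sub.
Qed.

Lemma well_approx_set_dilated psi :
  well_approx_set psi `<=` dilated_limsup psi setT `&` `[0, 1[.
Proof.
move=> x xW; split; last exact: well_approx_set_sub xW.
exists 1%N => N; have [[|n] /= Nn] := xW N I; first by rewrite approx_set0.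
by rewrite approx_setP// => -[_ xn]; exists n.+1; rewrite mul1r.
Qed.

(** The hypothesis says [psi' = o(psi)]: whatever M a point has, [M * psi' n] falls below [psi n]
    for large n. *)
Lemma dilated_well_approx_set psi psi' :
  (forall M : nat, exists N, forall n, (N <= n)%N -> (0 < n)%N -> M%:R * psi' n <= psi n) ->
  dilated_limsup psi' setT `&` `[0, 1[ `<=` well_approx_set psi.
Proof.
move=> psi'P x [[M xM] x01] N _; have [N' N'P] := psi'P M.
have [n [+ n0 _ [m cm xm]]] := xM (maxn N N'); rewrite geq_max => /andP[Nn N'n].
exists n => //; rewrite approx_setP//; split; first by move: x01; rewrite /= in_itv.
by exists m => //; apply: lt_le_trans xm _; exact: N'P.
Qed.

Lemma totient_ge1 n : (0 < n)%N -> 1 <= (totient n)%:R :> R.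
Proof. by move=> n0; rewrite (ler_nat _ 1) totient_gt0. Qed.

Lemma weight_ge0 psi : (forall n, (0 < n)%N -> 0 <= psi n) ->
  forall n, (0 < n)%N -> 0 <= psi n / n%:R * (totient n)%:R.
Proof. by move=> psi0 n n0; rewrite !mulr_ge0// psi0. Qed.

(* Divide [psi] by [1 + S_n], with [S_n] the partial sums of the divergent series:
   by Abel-Dini the series still diverges, so the smaller limsup set is not null,
   and [psi] eventually dominates every constant multiple of the smaller function. *)
Lemma well_approx_set_full psi :
  (forall psi' : nat -> R, (forall n, (0 < n)%N -> 0 <= psi' n) ->
    (\sum_(1 <= n <oo) (psi' n / n%:R * (totient n)%:R)%:E = +oo)%E ->
    mu (well_approx_set psi') != 0%E) ->
  (forall n, (0 < n)%N -> 0 <= psi n) ->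
  (\sum_(1 <= n <oo) (psi n / n%:R * (totient n)%:R)%:E = +oo)%E ->
  mu (well_approx_set psi) = 1%E.
Proof.
move=> pos psi0 psioo; pose a n := psi n / n%:R * (totient n)%:R.
have a0 : forall n, (0 < n)%N -> 0 <= a n by exact: weight_ge0.
have aub := (nneseries_pinftyP a a0).1 psioo.
pose S n := \sum_(1 <= m < n) a m.
have S0 n : 0 <= S n by rewrite /S big_nat_cond sumr_ge0// => i /andP[/andP[/a0]].
have S1 n : 0 < 1 + S n by rewrite ltr_pwDl.
pose psi' n := psi n / (1 + S n.+1).
have psi'0 n : (0 < n)%N -> 0 <= psi' n by move=> n0; rewrite divr_ge0 ?psi0// ltW.
have W'0 : mu (well_approx_set psi') != 0%E.
  apply: pos => //; apply/nneseries_pinftyP; first exact: weight_ge0.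
  apply: sum_unbounded_le (abel_dini a a0 aub) => n n0.
  by rewrite -/(S _) le_eqVlt; apply/orP; left; apply/eqP; rewrite /psi' /a; ring.
have V1 : (1 <= mu (dilated_limsup psi' setT `&` `[0%R, 1%R[))%E.
  apply: dilated_limsup_full.
  apply: (@lt_le_trans _ _ (mu (well_approx_set psi'))).
    by rewrite lt_def W'0 measure_ge0.
  apply: le_measure; rewrite ?inE; last exact: well_approx_set_dilated.
    exact: measurable_well_approx_set.
  by apply: measurableI => //; exact: measurable_dilated_limsup.
apply/eqP; rewrite eq_le well_approx_set_le1; apply: (le_trans V1).
apply: le_measure; rewrite ?inE; last first.
- apply: dilated_well_approx_set => M; have [N SN] := aub M%:R.
  exists N => n Nn n0; rewrite /psi' mulrCA ler_piMr ?psi0// ler_pdivrMr// mul1r.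
  apply: (le_trans SN); apply: (@le_trans _ _ (S n.+1)); last by rewrite lerDr.
  by apply: ler_sum_widen => //; exact: leqW.
- exact: measurable_well_approx_set.
- by apply: measurableI => //; exact: measurable_dilated_limsup.
Qed.

(* If [psi(n) / n >= e] infinitely often, the second series diverges because
   [phi(n) >= 1]; otherwise [f(psi(n) / n) <= psi(n) / n] eventually. *)
Lemma weighted_series_pinfty (f : R -> R) psi :
  (forall r, 0 <= r -> 0 <= f r) -> (forall r s, 0 <= r -> r < s -> f r < f s) ->
  r^-1 * f r @[r --> 0^'+] --> 0 ->
  (forall n, (0 < n)%N -> 0 <= psi n) ->
  (\sum_(1 <= n <oo) (f (psi n / n%:R) * (totient n)%:R)%:E = +oo)%E ->
  (\sum_(1 <= n <oo) (psi n / n%:R * (totient n)%:R)%:E = +oo)%E.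
Proof.
move=> f0 finc fcvg psi0 foo.
have r0 n : (0 < n)%N -> 0 <= psi n / n%:R by move=> /psi0 p0; rewrite divr_ge0.
have [e e0 fe] : exists2 e, 0 < e & forall r, 0 <= r < e -> f r <= r.
  have /cvgrPdist_le/(_ 1 ltr01) [e /= e0 He] := fcvg.
  have pos r : 0 < r < e -> f r <= r.
    move=> /andP[rp re]; have /= := He r; rewrite !sub0r !normrN gtr0_norm// => /(_ re rp).
    by move=> /ler_normlW; rewrite mulrC ler_pdivrMr// mul1r.
  (* The limit does not see [r = 0]. If [f 0 > 0], a small [t <= f 0] would give [f t <= t <= f 0],
     against strict monotonicity. *)
  exists e => // r /andP[]; rewrite le_eqVlt => /predU1P[<- _|rp re]; last by apply: pos; rewrite rp.
  rewrite leNgt; apply/negP => f00; pose t := Num.min (f 0) (e / 2).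
  have t0 : 0 < t by rewrite lt_min f00 divr_gt0.
  have te : t < e by rewrite gt_min orbC; apply/orP; left; lra.
  have := finc 0 t (lexx 0) t0; rewrite ltNge => /negP; apply.
  by apply: (le_trans (pos t _)); rewrite ?t0 ?te// ge_min lexx.
have a0 := weight_ge0 psi psi0.
apply/(nneseries_pinftyP _ a0).
have f0' n : (0 < n)%N -> 0 <= f (psi n / n%:R) * (totient n)%:R.
  by move=> n0; rewrite mulr_ge0 ?f0 ?r0.
have {}foo := (nneseries_pinftyP _ f0').1 foo.
have [[N rN]|/forallNP big] := pselect (exists N, forall n, (N < n)%N -> psi n / n%:R < e).
(* The first N terms, where [f r <= r] may fail, are requested on top of M and then cancelled. *)
- move=> M; have [K fK] := foo (M + \sum_(1 <= n < N.+1) f (psi n / n%:R) * (totient n)%:R).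
  exists K; rewrite -(lerD2r (\sum_(1 <= n < N.+1) f (psi n / n%:R) * (totient n)%:R)).
  apply: (le_trans fK); have [KN|NK] := leqP K N.+1.
    apply: (le_trans (ler_sum_widen _ _ _ f0' KN)); rewrite lerDr.
    by rewrite big_nat_cond sumr_ge0// => i /andP[/andP[/a0]].
  rewrite (big_cat_nat (n:=N.+1) (p:=K))//= 1?ltnW// addrC lerD2r.
  apply: (@le_trans _ _ (\sum_(N.+1 <= n < K) psi n / n%:R * (totient n)%:R)).
    apply: ler_sum_nat => n /andP[Nn _]; rewrite ler_wpM2r// fe//.
    by rewrite r0 ?rN// (leq_trans _ Nn).
  rewrite [leRHS](big_cat_nat (n:=N.+1) (p:=K))//= 1?ltnW// lerDr.
  by rewrite big_nat_cond sumr_ge0// => i /andP[/andP[/a0]].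
- have many k : exists N, k%:R * e <= \sum_(1 <= n < N) psi n / n%:R * (totient n)%:R.
    elim: k => [|k [N IH]]; first by exists 1%N; rewrite big_geq// mul0r.
    have /existsNP[n /not_implyP[Nn /negP]] := big N.
    rewrite -leNgt => en; have n0 : (0 < n)%N by exact: leq_trans Nn.
    exists n.+1; rewrite big_nat_recr//= -natr1 mulrDl mul1r lerD//.
      by apply: (le_trans IH); apply: ler_sum_widen => //; exact: ltnW.
    by rewrite -[e]mulr1 ler_pM ?totient_ge1// ltW.
  move=> M; have [N MN] := many (Num.trunc `|M / e|).+1; exists N; apply: le_trans MN.
  rewrite -ler_pdivrMr//; apply: (le_trans (ler_norm _)); exact/ltW/truncnS_gt.
Qed.

End WellApprox.

Theorem theorem1p7 (R : realType) :
  [<-> (* (i) *)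
       forall psi : nat -> R,
         (forall n, (0 < n)%N -> 0 <= psi n) ->
         (\sum_(1 <= n <oo) (psi n / n%:R * (totient n)%:R)%:E = +oo)%E ->
         lebesgue_measure (well_approx_set psi) = 1%E;
       (* (ii) *)
       forall f : R -> R,
         dimension_function f ->
         (forall r s, 0 < r -> r < s -> s^-1 * f s < r^-1 * f r) ->
         r^-1 * f r @[r --> 0^'+] --> +oo ->
         forall psi : nat -> R,
         (forall n, (0 < n)%N -> 0 <= psi n) ->
         (\sum_(1 <= n <oo) (psi n / n%:R * (totient n)%:R)%:E = +oo)%E ->
         hausdorff_measure f (well_approx_set psi) = +oo%E;
       (* (iii) *)
       forall f : R -> R,
         (forall r, 0 <= r -> 0 <= f r) ->
         (forall r s, 0 <= r -> r < s -> f r < f s) ->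
         r^-1 * f r @[r --> 0^'+] --> 0 ->
         forall psi : nat -> R,
         (forall n, (0 < n)%N -> 0 <= psi n) ->
         (\sum_(1 <= n <oo) (f (psi n / n%:R) * (totient n)%:R)%:E = +oo)%E ->
         lebesgue_measure (well_approx_set psi) = 1%E].
Proof.
split; [|split].
- move=> DS f _ _ fy psi psi0 psioo; apply: hausdorff_measure_pinfty fy.
    exact: measurable_well_approx_set.
  by rewrite DS.
- move=> HDS f f0 finc fcvg psi psi0 foo.
  apply: well_approx_set_full => //; last exact: weighted_series_pinfty foo.
  move=> psi' psi'0 psi'oo; apply/eqP => W0.
  have [g [dimg gdecr gy /eqP]] := null_set_gauge _ W0; apply.
  exact: HDS.
- move=> fDS psi psi0 psioo; pose r n := psi n / n%:R.
  pose a n := r n * (totient n)%:R.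
  have a0 : forall n, (0 < n)%N -> 0 <= a n by exact: weight_ge0.
  have ar n : (0 < n)%N -> a n != 0 -> 0 < r n.
    move=> n0 an0; rewrite lt_def; apply/andP; split; last by rewrite divr_ge0 ?psi0.
    by apply: contraNN an0 => /eqP; rewrite /a => ->; rewrite mul0r.
  have [g [g0 gmono gcvg goo]] := dini_gauge a r a0 ar ((nneseries_pinftyP a a0).1 psioo).
  have f0 x : 0 <= x -> 0 <= x * g x.
    rewrite le_eqVlt => /predU1P[<-|x0]; first by rewrite mul0r.
    by rewrite mulr_ge0 ?ltW ?g0.
  (* Strict monotonicity comes from the factor x, as g is only nondecreasing; at 0 the product
     vanishes whatever [g 0] is. *)
  apply: (fDS (fun x => x * g x)) => //.
  + move=> x y; rewrite le_eqVlt => /predU1P[<-|x0] xy; first by rewrite mul0r mulr_gt0 ?g0.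
    apply: (@le_lt_trans _ _ (x * g y)); first by rewrite ler_wpM2l ?gmono ?ltW.
    by rewrite ltr_pM2r// g0// (lt_trans x0).
  + apply: cvg_trans gcvg; apply: near_eq_cvg; near=> x.
    by rewrite mulrA mulVf ?mul1r// gt_eqF.
  + apply/nneseries_pinftyP.
      by move=> n n0; rewrite mulr_ge0// f0// divr_ge0 ?psi0.
    apply: sum_unbounded_le goo => n n0.
    by rewrite /a /r mulrCA mulrA.
Unshelve. all: by end_near. Qed.
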